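(* Let $X$ be a regular $T_1$ topological space. Then $(\mathcal{K}(X),\tau_V)$ has the compact-$G_\delta$-property if and only if $X$ has the compact-$G_\delta$-property and every compact subset of $X$ is metrizable.
   Context: $CL(X)$ is the set of all nonempty closed subsets of $X$; $\mathcal{K}(X)$ is the set of all nonempty compact subsets of $X$. The Vietoris topology $\tau_V$ on $CL(X)$ is generated by the sets $\langle U_1,\ldots,U_k\rangle=\{H\in CL(X): H\subset\bigcup_{i=1}^k U_i,\ H\cap U_j\neq\emptyset \text{ for } 1\leq j\leq k\}$, where $k\in\mathbb{N}$ and $U_1,\ldots,U_k$ are open in $X$; $\mathcal{K}(X)$ carries the subspace topology. A space $Y$ has the compact-$G_\delta$-property if every compact subset of $Y$ is a $G_\delta$-set in $Y$. *)

(* Defs.v *)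
From HB Require Import structures.
From mathcomp Require Import all_boot all_order all_algebra.
From mathcomp Require Import all_classical all_reals.
From mathcomp Require Import topology borel_hierarchy.

Set Implicit Arguments.
Unset Strict Implicit.
Unset Printing Implicit Defensive.

Local Open Scope classical_set_scope.

Definition CL (X : topologicalType) : Type :=
  set_type [set H : set X | closed H /\ H !=set0].

HB.instance Definition _ (X : topologicalType) :=
  Choice.copy (CL X) (set_type [set H : set X | closed H /\ H !=set0]).

Definition CL_val (X : topologicalType) (H : CL X) : set X := set_val H.

Definition vietoris_set (X : topologicalType) (k : nat) (U : 'I_k -> set X) :
    set (CL X) :=
  [set H | CL_val H `<=` \bigcup_i U i /\
           forall j, CL_val H `&` U j !=set0].

Definition vietoris_subbase (X : topologicalType) : set_system (CL X) :=
  [set B | exists (k : nat) (U : 'I_k.+1 -> set X),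
      (forall i, open (U i)) /\ B = vietoris_set U].

HB.instance Definition _ (X : topologicalType) :=
  isSubBaseTopological.Build (CL X) (@vietoris_subbase X) id.

(* As a set of points of [CL X], [K X] is a type through the coercion
   [set_type], with the subspace topology.  It contains only the closed compact
   sets; by [regular_T1_compact_closed] these are all the compact sets when X is
   regular and T1. *)
Definition K (X : topologicalType) : set (CL X) :=
  [set H | compact (CL_val H)].

Arguments K : clear implicits.

Lemma regular_T1_compact_closed (X : topologicalType) (A : set X) :
  regular_space X -> accessible_space X -> compact A -> closed A.
Proof.
move=> rX aX; apply: compact_closed => p q pq; apply/eqP/negPn/negP => npq.
have [V [oV]] := aX _ _ npq; rewrite !inE => pV nqV.
have [B pB BV] := rX p V (open_nbhs_nbhs (conj oV pV)).
by apply/nqV/BV => C qC; exact: pq.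
Qed.

Definition compact_Gdelta_property (Y : topologicalType) : Prop :=
  forall A : set Y, compact A -> Gdelta A.

(* [m] is a metric structure on the type underlying [T], bringing its own
   topology; the equation says that this topology is the one [T] already has. *)
Definition metrizable (R : realType) (T : topologicalType) : Prop :=
  exists m : Metric R T, @open (Metric.Pack m) = @open T.

(* Main.v *)
Require Import Defs.
From HB Require Import structures.
From mathcomp Require Import all_boot all_order all_algebra.
From mathcomp Require Import all_classical all_reals.
From mathcomp Require Import topology borel_hierarchy normedtype.
From mathcomp Require Import lra.

(** The compact-G-delta property of the hyperspace [K X] says two things about
[X], one read off from pairs of points, the other from countable bases.

From [K X] to [X].  The map sending (a, b) to the set {a, b} is continuous from
X * X to [K X].  Let A be compact in X.  The singletons {x} with x in A form a
compact, hence G-delta, subset of [K X].  Its preimage under x |-> {x} is A, so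
A is a G-delta; its preimage in A * A under the pair map is the diagonal, so
the compact Hausdorff space A has a G-delta diagonal and is therefore
metrizable ([Gdelta_diagonal_metrizable]).  For this last fact, write the
diagonal as the intersection of open sets F n and take Urysohn functions f n on
A * A that vanish on the diagonal and equal 1 off F n; then
  d (x, y) = sup over n and z of |f n (x, z) - f n (y, z)| / (n + 1)
is a metric.  Its balls are neighborhoods in A because A is compact, and a
continuous bijection from a compact space to a Hausdorff space is a
homeomorphism.

From [X] to [K X].  Let C be a compact subset of [K X].  Its union A is compact
in X ([bigcup_compact_family]), hence an intersection of open sets O n, and A
is metrizable, so countably many open sets V n of X trace a base on A.  Among
the compact sets contained in A, each H outside C is separated from each G in C
by one of the countably many open conditions that G is included in a finite
union of sets V n, or that G meets V n: if G is not included in H the second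
kind excludes H, otherwise the first kind does.  Compactness of C makes a
finite union of such conditions contain C and miss H, so C is the intersection
of the countably many open sets { G included in O n } and of those finite
unions that contain C ([metrizable_compact_Gdelta_K]).  *)

Set Implicit Arguments.
Unset Strict Implicit.
Unset Printing Implicit Defensive.

Import Order.TTheory GRing.Theory Num.Theory.
Import numFieldNormedType.Exports.

Local Open Scope classical_set_scope.

(** * Compactness and separation *)

(** The covering property of compact sets, for a family of neighborhoods stable
under finite unions; the space need not be inhabited. *)
Lemma compact_directed_cover (T : topologicalType) (A : set T)
    (U : set_system T) :
  compact A -> U set0 -> setU_closed U ->
  (forall x, A x -> exists2 V, U V & nbhs x V) ->
  exists2 V, U V & A `<=` V.
Proof.
move=> cA U0 UU covA; apply: contrapT => noV.
pose F := filter_from U (fun V => A `&` ~` V).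
have FF : ProperFilter F.
  apply: filter_from_proper.
    apply: filter_from_filter; first by exists set0.
    move=> V W UV UW; exists (V `|` W); first exact: UU.
    by rewrite setCU => x [Ax [nV nW]].
  move=> V UV; apply: contrapT => AV0.
  apply: noV; exists V => // x Ax; apply: contrapT => nVx.
  by apply: AV0; exists x.
have FA : F A by exists set0 => // x [].
have [x [Ax clx]] := cA F FF FA.
have [V UV xV] := covA x Ax.
have FV : F (A `&` ~` V) by exists V.
by have [y [[_ nVy] Vy]] := clx _ _ FV xV.
Qed.

Lemma continuous_cluster_eq (T U : topologicalType) (g : T -> U) (p q : T) :
  continuous g -> hausdorff_space U -> cluster (nbhs p) q -> g p = g q.
Proof.
move=> cg hU clpq; apply: hU => A B pA qB.
have [y [Ay By]] := clpq _ _ (cg p A pA) (cg q B qB).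
by exists (g y).
Qed.

Lemma hausdorff_prod (T U : topologicalType) :
  hausdorff_space T -> hausdorff_space U -> hausdorff_space (T * U)%type.
Proof.
move=> hT hU p q clpq; rewrite [p]surjective_pairing [q]surjective_pairing.
congr (_, _).
- apply: (@continuous_cluster_eq _ _ fst p q) => // x; exact: cvg_fst.
- apply: (@continuous_cluster_eq _ _ snd p q) => // x; exact: cvg_snd.
Qed.

Lemma set_type_hausdorff (T : topologicalType) (A : set T) :
  hausdorff_space T -> hausdorff_space A.
Proof.
move=> hT p q clpq; apply: val_inj.
exact: (continuous_cluster_eq (@initial_continuous A T set_val) hT clpq).
Qed.

Lemma regular_accessible_hausdorff (T : topologicalType) :
  regular_space T -> accessible_space T -> hausdorff_space T.
Proof.
move=> rT aT p q pq; apply/eqP/negPn/negP => npq.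
have [V [oV]] := aT _ _ npq; rewrite !inE => pV nqV.
have [B pB BV] := rT p V (open_nbhs_nbhs (conj oV pV)).
by apply/nqV/BV => C qC; exact: pq.
Qed.

Lemma compact_set_type (T : topologicalType) (A : set T) :
  compact A -> compact [set: A].
Proof.
move=> cA F FF _.
have FA : (set_val @ F) A.
  by apply: (@filterE _ F) => -[x Ax]; exact: set_mem Ax.
have [x [Ax clx]] := cA (set_val @ F) (fmap_proper_filter set_val FF) FA.
exists (exist _ x (mem_set Ax)); split => // P Q FP [_ [[V oV <-] Vx] VQ].
have FvP : (set_val @ F) (set_val @` P).
  by apply: (@filterS _ F _ P) => // y Py; exists y.
have [_ [[y Py <-] Vy]] := clx _ _ FvP (open_nbhs_nbhs (conj oV Vx)).
by exists y; split => //; exact: VQ.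
Qed.

Lemma compact_continuous_image (T U : topologicalType) (f : T -> U)
    (A : set T) : continuous f -> compact A -> compact (f @` A).
Proof.
by move=> cf; apply: continuous_compact; exact: continuous_subspaceT.
Qed.

Lemma diagonal_map_continuous (T : topologicalType) :
  continuous (fun x : T => (x, x)).
Proof. by move=> x; apply: cvg_pair; exact: cvg_id. Qed.

Lemma continuous_comp_diagonal (T U : topologicalType) (p : T * T -> U) :
  continuous p -> continuous (fun x => p (x, x)).
Proof.
move=> cp x; apply: (@continuous_comp _ _ _ (fun x : T => (x, x)) p).
  exact: diagonal_map_continuous.
exact: cp.
Qed.

(** * G-delta sets *)

Lemma Gdelta_preimage (T U : topologicalType) (f : T -> U) (S : set U) :
  continuous f -> Gdelta S -> Gdelta (f @^-1` S).
Proof.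
move=> /continuousP cf [F oF ->]; exists (fun n => f @^-1` F n).
  by move=> n; exact: cf.
by rewrite preimage_bigcap.
Qed.

(** Only countably many open sets are intersected, whatever the countable index
type; the indices outside [D], and the naturals coding no index, contribute the
whole space. *)
Lemma bigcap_open_Gdelta (T : topologicalType) (I : countType) (D : set I)
    (W : I -> set T) :
  (forall i, D i -> open (W i)) -> Gdelta (\bigcap_(i in D) W i).
Proof.
move=> oW.
pose F n := if unpickle n is Some i then
  if pselect (D i) then W i else setT else setT : set T.
exists F => [n|].
  rewrite /F; case: unpickle => [i|]; last exact: openT.
  by case: pselect => Di; [exact: oW|exact: openT].
apply/seteqP; split=> x.
  move=> Wx n _; rewrite /F; case: unpickle => [i|//].
  by case: pselect => // Di; exact: Wx.
move=> Fx i Di; have := Fx (pickle i) Logic.I; rewrite /F pickleK.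
by case: pselect.
Qed.
(** * Metrization of compact spaces with a G-delta diagonal *)

Section dist_space.
Context {R : realType} {T : choiceType} {d : T -> T -> R}.
Hypothesis d0 : forall x, d x x = 0%R.
Hypothesis dpos : forall x y, d x y = 0%R -> x = y.
Hypothesis dsym : forall x y, d x y = d y x.
Hypothesis dtri : forall y x z, (d x z <= d x y + d y z)%R.

(** The set [T] with the metric topology of the distance [d]; the unused tuple
of axioms makes them parameters of the type. *)
Definition dist_space : Type := let _ := (d0, dpos, dsym, dtri) in T.

HB.instance Definition _ := Choice.on dist_space.
HB.instance Definition _ := isMetric.Build R dist_space d0 dpos dsym dtri.

End dist_space.

(** On a compact space, it is enough that the balls of a metric be
neighborhoods: the identity is then a continuous bijection from a compact space
onto a Hausdorff one. *)
Lemma metrizable_compact (R : realType) (T : topologicalType)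
    (d : T -> T -> R) :
  compact [set: T] ->
  (forall x, d x x = 0%R) ->
  (forall x y, d x y = 0%R -> x = y) ->
  (forall x y, d x y = d y x) ->
  (forall y x z, (d x z <= d x y + d y z)%R) ->
  (forall x e, (0 < e)%R -> \forall y \near x, (d x y < e)%R) ->
  metrizable R T.
Proof.
move=> cT d0 dpos dsym dtri dnear.
pose M : metricType R := dist_space d0 dpos dsym dtri.
exists (Metric.class M); rewrite -[Metric.Pack _]/M.
have cid : continuous (id : T -> M).
  move=> x U /nbhs_ballP[e e0 xeU]; apply: filterS (dnear x e e0) => y xy.
  by apply: xeU; rewrite ballEmdist.
apply/seteqP; split=> U.
  by move/continuousP : cid => /[apply].
move=> oU; rewrite -[U]setCK; apply: closed_openC.
apply: compact_closed; first exact: metric_hausdorff.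
rewrite -[~` U]image_id; apply: (@compact_continuous_image T M) => //.
by apply: subclosed_compact cT _ => //; exact: open_closedC.
Qed.

Section diagonal_metric.
Context {R : realType} {T : topologicalType}.
Variable f : nat -> T * T -> R.
Hypothesis cf : forall n, continuous (f n).
Hypothesis f01 : forall n p, (0 <= f n p <= 1)%R.
Hypothesis f_diag : forall n x, f n (x, x) = 0%R.
Hypothesis f_off : forall x y, x <> y -> exists n, f n (x, y) = 1%R.
Hypothesis cT : compact [set: T].

Local Open Scope ring_scope.

(** The n-th function separates x and y at the point z by [gap x y (n, z)]; the
weight makes all but finitely many n negligible. *)
Definition gap (x y : T) (i : nat * T) : R :=
  i.1.+1%:R^-1 * `|f i.1 (x, i.2) - f i.1 (y, i.2)|.

(** The distance induced by functions that vanish on the diagonal of T * T. *)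
Definition diag_dist (x y : T) : R := sup (range (gap x y)).

Lemma gap_le_invn x y i : gap x y i <= i.1.+1%:R^-1.
Proof.
rewrite /gap ler_piMr ?invr_ge0// ler_norml.
have := f01 i.1 (x, i.2); have := f01 i.1 (y, i.2).
by lra.
Qed.

Lemma gap_le_dist x y i : gap x y i <= diag_dist x y.
Proof.
apply: ub_le_sup; last by exists i.
exists 1 => _ [j _ <-]; apply: (le_trans (gap_le_invn _ _ _)).
by rewrite invf_le1// ler1n.
Qed.

Lemma diag_dist_le x y e : (forall i, gap x y i <= e) -> diag_dist x y <= e.
Proof.
move=> le_e; apply: ge_sup; first by exists (gap x y (0%N, x)), (0%N, x).
by move=> _ [i _ <-].
Qed.

Lemma diag_distxx x : diag_dist x x = 0.
Proof.
apply/le_anti/andP; split; last first.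
  apply: le_trans (gap_le_dist _ _ (0%N, x)).
  by rewrite /gap mulr_ge0// invr_ge0.
by apply: diag_dist_le => i; rewrite /gap subrr normr0 mulr0.
Qed.

Lemma diag_dist_eq0 x y : diag_dist x y = 0 -> x = y.
Proof.
move=> dxy; apply: contrapT => /f_off[n fn1].
have := gap_le_dist x y (n, y); rewrite dxy /gap /= fn1 f_diag subr0 normr1.
by rewrite mulr1 leNgt invr_gt0 ltr0n.
Qed.

Lemma diag_distC x y : diag_dist x y = diag_dist y x.
Proof.
rewrite /diag_dist; suff -> : gap x y = gap y x by [].
by apply/funext => i; rewrite /gap distrC.
Qed.

Lemma diag_dist_triangle y x z :
  diag_dist x z <= diag_dist x y + diag_dist y z.
Proof.
apply: diag_dist_le => i.
apply: le_trans (lerD (gap_le_dist x y i) (gap_le_dist y z i)).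
by rewrite /gap -mulrDr ler_wpM2l ?invr_ge0// ler_distD.
Qed.

(** The balls of [diag_dist] are neighborhoods for the topology of [T]. *)
Lemma diag_dist_near x e : 0 < e -> \forall y \near x, diag_dist x y < e.
Proof.
move=> e0; have e20 : 0 < e / 2 by rewrite divr_gt0.
have [N] := ltr_add_invr e20; rewrite add0r => ltN.
(* Compactness in z makes the joint continuity of [f n] uniform in z. *)
have unif n : \forall y \near x, forall z, `|f n (x, z) - f n (y, z)| < e / 2.
  have /compact_near_coveringP cov := cT.
  suff : \forall y \near x, [set: T] `<=`
      [set z | `|f n (x, z) - f n (y, z)| < e / 2].
    by apply: filterS => y h z; exact: h.
  apply: (cov T (nbhs x)
    (fun y z => `|f n (x, z) - f n (y, z)| < e / 2)) => z _.
  have xz := @cf n (x, z).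
  have e40 : 0 < e / 2 / 2 by rewrite divr_gt0.
  have /cvgrPdist_lt/(_ _ e40) [[P Q] /= [xP zQ] PQ] := xz.
  exists (Q, P) => //= -[z' y] /= [Qz' Py].
  have h1 := PQ (x, z') (conj (nbhs_singleton xP) Qz').
  have h2 := PQ (y, z') (conj Py Qz').
  rewrite /= in h1 h2; rewrite (splitr (e / 2)).
  apply: le_lt_trans (ler_distD (f n (x, z)) _ _) _.
  by rewrite ltrD// distrC.
have unifN : \forall y \near x, forall n : 'I_N, forall z,
    `|f n (x, z) - f n (y, z)| < e / 2.
  by apply: filter_forall => n; exact: unif.
apply: filterS unifN => y fxy.
apply: (@le_lt_trans _ _ (e / 2)); last by lra.
(* The weight settles the indices n >= N. *)
apply: diag_dist_le => -[n z]; have [nN|Nn] := ltnP n N.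
  rewrite /gap /=; apply: le_trans (ltW (fxy (Ordinal nN) z)).
  by rewrite ler_piMl// invf_le1// ler1n.
apply: le_trans (gap_le_invn _ _ _) _ => /=.
apply: le_trans (ltW ltN); rewrite lef_pV2 ?posrE ?ltr0n//.
by rewrite ler_nat.
Qed.

Lemma diag_dist_metrizable : metrizable R T.
Proof.
exact: (metrizable_compact cT diag_distxx diag_dist_eq0 diag_distC
          diag_dist_triangle diag_dist_near).
Qed.

End diagonal_metric.

(** Sneider's theorem. *)
Lemma Gdelta_diagonal_metrizable (R : realType) (T : topologicalType) :
  compact [set: T] -> hausdorff_space T ->
  Gdelta [set p : T * T | p.1 = p.2] -> metrizable R T.
Proof.
move=> cT hT [F oF diagF].
have hTT := hausdorff_prod hT hT.
have cTT : compact [set: T * T] by rewrite -setXTT; exact: compact_setX.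
have clD : closed [set p : T * T | p.1 = p.2].
  apply: compact_closed => //.
  have -> : [set p : T * T | p.1 = p.2] = (fun x => (x, x)) @` [set: T].
    apply/seteqP; split=> [[x y] /= ->|_ [x _ <-]//]; by exists y.
  by apply: compact_continuous_image cT; exact: diagonal_map_continuous.
have sep n : exists f : T * T -> R, [/\ continuous f,
    range f `<=` [set r | 0 <= r <= 1]%R,
    f @` [set p | p.1 = p.2] `<=` [set 0%R] & f @` (~` F n) `<=` [set 1%R]].
  apply/uniform_separatorP.
  apply: (iffLR (@normal_separatorP R _) (compact_normal hTT cTT)) => //.
    exact/open_closedC.
  apply/disjoints_subset; rewrite setCK diagF => p; exact.
pose f n := projT1 (cid (sep n)).
have fP n : [/\ continuous (f n), range (f n) `<=` [set r | 0 <= r <= 1]%R,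
    f n @` [set p | p.1 = p.2] `<=` [set 0%R] & f n @` (~` F n) `<=` [set 1%R]].
  exact: projT2 (cid (sep n)).
apply: (@diag_dist_metrizable R T f) => //.
- by move=> n; have [] := fP n.
- move=> n p; have [_ r01 _ _] := fP n.
  by apply: r01; exists p.
- by move=> n x; have [_ _ f0 _] := fP n; apply: f0; exists (x, x).
- move=> x y xy; have : ~ (\bigcap_n F n) (x, y) by rewrite -diagF.
  move=> /existsNP[n /not_implyP[_ nF]]; exists n.
  by have [_ _ _ f1] := fP n; apply: f1; exists (x, y).
Qed.

(** * The Vietoris topology *)

(** Continuity of a map into the hyperspace can be tested on the two kinds of
sets { H included in U } and { H meeting U }. *)
Lemma vietoris_continuous (T X : topologicalType) (f : T -> CL X) :
  (forall (U : set X), open U -> open [set t | CL_val (f t) `<=` U]) ->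
  (forall (U : set X), open U -> open [set t | CL_val (f t) `&` U !=set0]) ->
  continuous f.
Proof.
move=> sub meet; apply/continuousP => _ [D Dfin <-].
rewrite preimage_bigcup; apply: bigcup_open => B /Dfin [S SV <-].
rewrite openE => t St; rewrite /interior preimage_bigcap.
apply: (@filter_bigI _ _ S (fun B => f @^-1` B)) => C CS.
have /set_mem[k [U [oU CE]]] := SV C CS.
apply: open_nbhs_nbhs; split; last exact: St.
rewrite CE.
have -> : f @^-1` vietoris_set U =
    [set t | CL_val (f t) `<=` \bigcup_i U i] `&`
    \bigcap_i [set t | CL_val (f t) `&` U i !=set0].
  by apply/seteqP; split=> s [sU sm]; split=> // i *; exact: sm.
apply: openI; first by apply: sub; exact: bigcup_open.
rewrite openE => s sU; rewrite /interior.
have : \forall s' \near s, forall i, CL_val (f s') `&` U i !=set0.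
  apply: filter_forall => i; apply: open_nbhs_nbhs; split; last exact: sU.
  exact: meet.
by apply: filterS => s' h i _; exact: h.
Qed.

Lemma vietoris_set_open (X : topologicalType) (k : nat) (U : 'I_k.+1 -> set X) :
  (forall i, open (U i)) -> open (vietoris_set U).
Proof.
move=> oU; exists [set vietoris_set U]; last by rewrite bigcup_set1.
by move=> _ ->; apply: finI_from1; exists k, U.
Qed.

(** The subset of [X] underlying a point of [K X]. *)
Definition Kval (X : topologicalType) (G : K X) : set X := CL_val (set_val G).

Section hyperspace.
Context {X : topologicalType}.
Implicit Types (U : set X) (G H : K X).

Lemma Kval_compact G : compact (Kval G).
Proof. exact: (set_mem (valP G)). Qed.

Lemma Kval_closed G : closed (Kval G).
Proof. by have [] := set_mem (valP (set_val G)). Qed.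

Lemma Kval_nonempty G : Kval G !=set0.
Proof. by have [] := set_mem (valP (set_val G)). Qed.

Lemma Kval_inj : injective (@Kval X).
Proof. by move=> G H GH; do 2 apply: val_inj. Qed.

Lemma Kval_sub_open U : open U -> open [set G | Kval G `<=` U].
Proof.
move=> oU; (* A nonempty set included in U meets U, so this is the set <U>. *)
exists (vietoris_set (fun _ : 'I_1 => U)).
  exact: vietoris_set_open.
apply/seteqP; split=> G; first by move=> [GU _] x /GU [].
move=> GU; split=> [x /GU|_]; first by exists ord0.
by have [x Gx] := Kval_nonempty G; exists x; split => //; exact: GU.
Qed.

Lemma Kval_meet_open U : open U -> open [set G | Kval G `&` U !=set0].
Proof.
move=> oU; (* This is the set <X, U>. *)
exists (vietoris_set (fun i : 'I_2 => if i == ord0 then setT else U)).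
  by apply: vietoris_set_open => i; case: ifP => // _; exact: openT.
apply/seteqP; split=> G; first by move=> [_ /(_ ord_max)].
move=> GU; split=> [x _|i]; first by exists ord0.
by case: ifP => // _; rewrite setIT; exact: Kval_nonempty.
Qed.

Lemma K_continuous (T : topologicalType) (f : T -> K X) :
  (forall U, open U -> open [set t | Kval (f t) `<=` U]) ->
  (forall U, open U -> open [set t | Kval (f t) `&` U !=set0]) ->
  continuous f.
Proof.
move=> sub meet; apply: continuous_comp_initial.
exact: vietoris_continuous.
Qed.

End hyperspace.

Lemma pair_map_continuous (X : topologicalType) : hausdorff_space X ->
  exists2 p : X * X -> K X,
    continuous p & forall a b, Kval (p (a, b)) = [set a; b].
Proof.
move=> hX.
have cpt (ab : X * X) : compact [set ab.1; ab.2].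
  by apply: finite_compact; exact: finite_set2.
have cl (ab : X * X) : closed [set ab.1; ab.2] /\ [set ab.1; ab.2] !=set0.
  by split; [exact: compact_closed|exists ab.1; left].
pose q ab : CL X := exist _ [set ab.1; ab.2] (mem_set (cl ab)).
have Kq ab : K X (q ab) by exact: cpt.
pose p ab : K X := exist _ (q ab) (mem_set (Kq ab)).
have pE ab : Kval (p ab) = [set ab.1; ab.2] by [].
have o1 (U : set X) : open U -> open (fst @^-1` U : set (X * X)).
  by move=> oU; apply: open_comp => // x _; exact: cvg_fst.
have o2 (U : set X) : open U -> open (snd @^-1` U : set (X * X)).
  by move=> oU; apply: open_comp => // x _; exact: cvg_snd.
exists p => //; apply: K_continuous => U oU.
  rewrite (_ : mkset _ = fst @^-1` U `&` snd @^-1` U).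
    by apply: openI; [exact: o1|exact: o2].
  apply/seteqP; split=> ab; rewrite /= pE.
    by move=> h; split; apply: h; [left|right].
  by move=> [Ua Ub] x [|] ->.
rewrite (_ : mkset _ = fst @^-1` U `|` snd @^-1` U).
  by apply: openU; [exact: o1|exact: o2].
apply/seteqP; split=> ab; rewrite /= pE.
  by move=> [x [[|] -> Ux]]; [left|right].
by move=> [Ua|Ub]; [exists ab.1|exists ab.2]; split => //; [left|right].
Qed.

(** The union of a compact family of compact sets is compact. *)
Lemma bigcup_compact_family (X : topologicalType) (C : set (K X)) :
  compact C -> compact (\bigcup_(G in C) Kval G).
Proof.
move=> /compact_near_coveringP cC; apply/compact_near_coveringP => I F P FF cov.
suff : \forall i \near F, C `<=` [set G | Kval G `<=` P i].
  by apply: filterS => i CP x [G CG Gx]; exact: CP CG x Gx.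
apply: (cC I F (fun i G => Kval G `<=` P i)) => G CG.
(* [Us]: the open sets on which [P] holds uniformly along [F]; compactness of G
provides one that includes G. *)
pose Us := [set U : set X | open U /\
  exists2 J, F J & forall i x, J i -> U x -> P i x].
have [|||V [oV [J FJ JP]] GV] :=
  @compact_directed_cover X (Kval G) Us (@Kval_compact X G).
- by split; [exact: open0|exists setT => //; exact: filterT].
- move=> U V [oU [J FJ JP]] [oV [L FL LP]]; split; first exact: openU.
  exists (J `&` L); first exact: filterI.
  by move=> i x [Ji Li] [Ux|Vx]; [exact: JP|exact: LP].
- move=> x Gx; have [|[U J] /= [xU FJ] UJP] := cov x; first by exists G.
  exists U°; last exact: nbhs_interior.
  split; first exact: open_interior.
  exists J => // i y Ji Uy; apply: (UJP (y, i)); split => //.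
  exact: interior_subset.
exists ([set H | Kval H `<=` V], J).
  split => //; apply: open_nbhs_nbhs; split => //; exact: Kval_sub_open.
by move=> [H i] /= [HV Ji] x Hx; apply: JP => //; exact: HV.
Qed.

(** * Compact sets of compact sets *)

Lemma bigcup_seq_cat (I : eqType) (T : Type) (F : I -> set T) (s t : seq I) :
  \bigcup_(i in [set` s ++ t]) F i =
  \bigcup_(i in [set` s]) F i `|` \bigcup_(i in [set` t]) F i.
Proof.
rewrite -bigcup_setU; congr (\bigcup_(i in _) _).
by apply/seteqP; split=> i /=; rewrite mem_cat => /orP.
Qed.

Lemma bigcup_seq1 (I : eqType) (T : Type) (F : I -> set T) (i : I) :
  \bigcup_(j in [set` [:: i]]) F j = F i.
Proof.
apply/seteqP; split=> x; last by move=> Fx; exists i => //=; rewrite inE.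
by move=> [j]; rewrite /= inE => /eqP ->.
Qed.

Lemma compact_pseudometric_second_countable (R : realType)
    (M : pseudoMetricType R) : compact [set: M] -> @second_countable M.
Proof.
move=> cM; have [[x _]|M0] := pselect ([set: M] !=set0).
  pose M' : pseudoPMetricType R :=
    HB.pack (PseudoMetric.sort M) M (isPointed.Build (PseudoMetric.sort M) x).
  exact: (@compact_second_countable R M').
(* An empty space has the empty base. *)
exists set0; first exact: countable0.
by split=> // x; exfalso; apply: M0; exists x.
Qed.

Lemma metrizable_second_countable (R : realType) (T : topologicalType) :
  compact [set: T] -> metrizable R T -> @second_countable T.
Proof.
move=> cT [m openE]; pose M : metricType R := Metric.Pack m.
have TM : continuous (id : T -> M) by apply/continuousP => A; rewrite openE.
have MT : continuous (id : M -> T) by apply/continuousP => A; rewrite openE.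
have cM : compact [set: M].
  by rewrite -(image_id [set: M]); apply: (@compact_continuous_image T M).
have [B cB [oB bB]] := @compact_pseudometric_second_countable R M cM.
exists B => //; split=> [U BU|x U xU]; first by rewrite -openE; exact: oB.
by apply: bB; exact: MT.
Qed.

(** Countably many open sets of the ambient space trace a base on a compact
metrizable subset. *)
Lemma metrizable_outer_base (R : realType) (X : topologicalType) (A : set X) :
  compact A -> metrizable R A ->
  exists2 V : nat -> set X, forall n, open (V n) &
    forall x U, A x -> nbhs x U -> exists2 n, V n x & A `&` V n `<=` U.
Proof.
move=> cA mA.
have [B /countable_injP[c cinj] [oB bB]] :=
  metrizable_second_countable (compact_set_type cA) mA.
(* [c] numbers the members of a countable base of A; the n-th open set is the
largest one whose trace is the member numbered n. *)
pose fam n := [set W : set X | [/\ open W,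
  B (set_val @^-1` W : set A) & c (set_val @^-1` W) = n]].
exists (fun n => \bigcup_(W in fam n) W) => [n|x U Ax xU].
  by apply: bigcup_open => W [].
pose a : A := exist _ x (mem_set Ax).
have [|S [BS Sa] SU] := bB a (set_val @^-1` U).
  exact: (@initial_continuous A X set_val a).
have [W oW WS] := oB _ BS.
exists (c S); first by exists W; [split=> //; rewrite WS|rewrite -WS in Sa].
move=> y [Ay [W' [oW' BW' cW'] W'y]].
have W'S : set_val @^-1` W' = S by apply: cinj => //; exact: mem_set.
pose b : A := exist _ y (mem_set Ay).
have Sb : S b by rewrite -W'S.
exact: (SU b Sb).
Qed.

Lemma metrizable_compact_Gdelta_K (R : realType) (X : topologicalType) :
  hausdorff_space X -> compact_Gdelta_property X ->
  (forall A : set X, compact A -> metrizable R A) ->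
  compact_Gdelta_property (K X).
Proof.
move=> hX GX mX C cC.
pose A := \bigcup_(G in C) Kval G.
have cA : compact A by exact: bigcup_compact_family.
have [O oO AO] := GX A cA.
have [V oV Vbase] := metrizable_outer_base cA (mX A cA).
pose Vs (s : seq nat) := \bigcup_(n in [set` s]) V n.
have oVs s : open (Vs s) by apply: bigcup_open => n _; exact: oV.
pose E (i : seq nat + nat) : set (K X) :=
  match i with
  | inl s => [set G | Kval G `<=` Vs s]
  | inr n => [set G | Kval G `&` V n !=set0]
  end.
have oE i : open (E i).
  by case: i => [s|n]; [exact: Kval_sub_open|exact: Kval_meet_open].
pose W (j : nat + seq (seq nat + nat)) : set (K X) :=
  match j with
  | inl n => [set G | Kval G `<=` O n]
  | inr t => \bigcup_(i in [set` t]) E i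
  end.
have oW j : open (W j).
  by case: j => [n|t]; [exact: Kval_sub_open|apply: bigcup_open].
(* The right-hand side has a countable index set. *)
suff -> : C = \bigcap_(j in [set j | C `<=` W j]) W j.
  by apply: bigcap_open_Gdelta => j _.
apply/seteqP; split=> [G CG j|H HW]; first exact.
have HA : Kval H `<=` A.
  rewrite AO => x Hx n _; apply: (HW (inl n)) => // G CG y Gy.
  have : A y by exists G.
  by rewrite AO; exact.
apply: contrapT => nCH.
(* [Us]: the finite unions of basic conditions that H does not satisfy. *)
pose Us := [set U : set (K X) | exists2 t, U = W (inr t) & ~ U H].
have [|||_ [t -> nHt] Ct] := @compact_directed_cover (K X) C Us cC.
- exists [::]; last by [].
  by apply/seteqP; split => // G [].
- move=> _ _ [s -> nHs] [t -> nHt]; exists (s ++ t); last by case.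
  by rewrite /W bigcup_seq_cat.
- move=> G CG.
  have inUs i : E i G -> ~ E i H -> exists2 U, Us U & nbhs G U.
    move=> iG niH; exists (W (inr [:: i])).
      by exists [:: i] => //; rewrite /W bigcup_seq1.
    by apply: open_nbhs_nbhs; split; [exact: oW|rewrite /W bigcup_seq1].
  (* A point x of G outside H gives a V n that meets G but not H. *)
  have [GH|] := pselect (Kval G `<=` Kval H); last first.
    move=> /existsNP[x /not_implyP[Gx nHx]].
    have [||n Vx VH] := Vbase x (~` Kval H); first by exists G.
      apply: open_nbhs_nbhs; split => //.
      by apply: closed_openC; exact: Kval_closed.
    apply: (inUs (inr n)); first by exists x.
    by move=> [y [Hy Vy]]; apply: (VH y) => //; split => //; exact: HA.
  have /existsNP[x /not_implyP[Hx nGx]] : ~ (Kval H `<=` Kval G).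
    move=> HG; apply: nCH; suff -> : H = G by [].
    by apply: Kval_inj; apply/seteqP.
  (* A point x of H is outside G: cover G by finitely many V n avoiding x. *)
  pose Ss := [set U : set X | exists2 s, U = Vs s & ~ U x].
  have [|||_ [s -> nxs] Gs] :=
    @compact_directed_cover X (Kval G) Ss (@Kval_compact X G).
  + by exists [::] => //; apply/seteqP; split => // y [].
  + move=> _ _ [s -> nxs] [t -> nxt]; exists (s ++ t); last by case.
    by rewrite /Vs bigcup_seq_cat.
  + move=> y Gy.
    have [||n Vy Vx] := Vbase y (~` [set x]); first by exists G.
      apply: open_nbhs_nbhs; split => [|yx].
        apply: closed_openC; apply: accessible_closed_set1.
        exact: hausdorff_accessible.
      by apply: nGx; rewrite -yx.
    exists (V n); last by apply: open_nbhs_nbhs; split.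
    exists [:: n]; last first.
      by move=> Vnx; apply: (Vx x) => //; split => //; exact: HA.
    by rewrite /Vs bigcup_seq1.
  apply: (inUs (inl s)) => // Hs.
  exact/nxs/Hs.
- by apply: nHt; apply: (HW (inr t)).
Qed.

Lemma compact_Gdelta_K_base (X : topologicalType) : hausdorff_space X ->
  compact_Gdelta_property (K X) -> compact_Gdelta_property X.
Proof.
move=> hX GK A cA; have [p cp pE] := pair_map_continuous hX.
have cs := continuous_comp_diagonal cp.
have := Gdelta_preimage cs (GK _ (compact_continuous_image cs cA)).
congr Gdelta; apply/seteqP; split=> x; last by exists x.
move=> [a Aa] /(congr1 (@Kval X)); rewrite !pE !setUid => ax.
by have <- : a = x by have : [set x] x by []; rewrite -ax.
Qed.

Lemma compact_Gdelta_K_metrizable (R : realType) (X : topologicalType)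
    (A : set X) :
  hausdorff_space X -> compact_Gdelta_property (K X) -> compact A ->
  metrizable R A.
Proof.
move=> hX GK cA; have [p cp pE] := pair_map_continuous hX.
have cs := continuous_comp_diagonal cp.
pose i (ab : A * A) : X * X := (set_val ab.1, set_val ab.2).
have ci : continuous i.
  move=> ab; apply: cvg_pair.
    apply: (@continuous_comp _ _ _ fst set_val); first exact: cvg_fst.
    exact: initial_continuous.
  apply: (@continuous_comp _ _ _ snd set_val); first exact: cvg_snd.
  exact: initial_continuous.
have cpi : continuous (p \o i).
  by move=> ab; apply: continuous_comp; [exact: ci|exact: cp].
apply: Gdelta_diagonal_metrizable.
- exact: compact_set_type.
- exact: set_type_hausdorff.
have := Gdelta_preimage cpi (GK _ (compact_continuous_image cs cA)).
congr Gdelta; apply/seteqP; split=> -[a b].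
  move=> [x Ax] /(congr1 (@Kval X)); rewrite /= !pE setUid => xab.
  have ax : set_val a = x.
    by have : [set set_val a; set_val b] (set_val a) by [left]; rewrite -xab.
  have bx : set_val b = x.
    by have : [set set_val a; set_val b] (set_val b) by [right]; rewrite -xab.
  by apply: val_inj; rewrite /= -!set_valE ax bx.
by move=> /= <-; exists (set_val a) => //; exact: set_mem (valP a).
Qed.

Theorem theorem4p1 (R : realType) (X : topologicalType)
    (Xregular : regular_space X) (XT1 : accessible_space X) :
  compact_Gdelta_property (K X) <->
  compact_Gdelta_property X /\
  (forall A : set X, compact A -> metrizable R A).
Proof.
have hX := regular_accessible_hausdorff Xregular XT1.
split=> [GK|[GX mX]]; last exact: metrizable_compact_Gdelta_K hX GX mX.
split; first exact: compact_Gdelta_K_base.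
by move=> A; exact: compact_Gdelta_K_metrizable.
Qed.
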